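(* Fix an integer $d\ge2$. For every choice of $\mathbf p=\mathbf p(n)=(p_1,p_2,\dots,p_d)\in(0,1]^d$, $n\ge1$, such that $np_d\to\infty$ as $n\to\infty$, the multi-parameter upper model $Z=Z_d(n,\mathbf p)$ satisfies $$\frac{|Z^{d-1}|}{\binom nd}\to1\quad\text{almost surely as } n\to\infty.$$
   Context: The model $Z_d(n,\mathbf p)$ (multi-parameter upper model): let $\mathcal X(n,\mathbf p)$ be the random hypergraph on $[n]=\{1,\dots,n\}$ in which, for each $1\le j\le d$, each subset of $[n]$ of cardinality $j+1$ (a $j$-cell) is included independently with probability $p_j$. Then $Z_d(n,\mathbf p)=\bigcup_{\sigma\in\mathcal X(n,\mathbf p)}\{\sigma':\sigma'\subseteq\sigma\}$ is the smallest simplicial complex containing $\mathcal X(n,\mathbf p)$. $Z^{d-1}$ is the set of $(d-1)$-cells of $Z$, i.e. elements of $Z$ of cardinality $d$. The complexes for all $n$ are defined on a common probability space, from a triangular family of independent Bernoulli variables $\chi_\tau^{(n)}$ (with parameter $p_{|\tau|-1}(n)$) indicating $\tau\in\mathcal X(n,\mathbf p)$. *)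

(* Defs.v *)
From HB Require Import structures.
From mathcomp Require Import all_boot all_order all_algebra.
From mathcomp Require Import all_classical all_reals all_analysis.

Set Implicit Arguments.
Unset Strict Implicit.
Unset Printing Implicit Defensive.

Import Order.TTheory GRing.Theory Num.Theory.
Import numFieldNormedType.Exports.

Local Open Scope classical_set_scope.
Local Open Scope ring_scope.

(* Mutual independence under P of the subfamily (X i), i \in D, of random
   variables: the product rule over every finite subset of D. *)
Definition mutually_independent (disp disp' : measure_display)
    (T : measurableType disp) (T' : measurableType disp') (R : realType)
    (P : probability T R) (I : eqType) (D : pred I)
    (X : I -> {RV P >-> T'}) : Prop :=
  forall (s : seq I) (B : I -> set T'),
    uniq s -> all D s -> (forall i, measurable (B i)) ->
    P (\big[setI/setT]_(i <- s) (X i @^-1` B i)) =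
    (\prod_(i <- s) P (X i @^-1` B i))%E.

(* The vertex set [n] is 'I_n; a j-cell is a subset with j + 1 elements. The
   potential members of the random hypergraph are the j-cells, 1 <= j <= d. *)
Definition eligible (d n : nat) (tau : {set 'I_n}) : bool :=
  (1 <= #|tau|.-1 <= d)%N.

Definition hypergraph (d n : nat) (x : {set 'I_n} -> bool) : {set {set 'I_n}} :=
  [set tau : {set 'I_n} | eligible d tau && x tau]%SET.

Definition upper_complex (n : nat) (X : {set {set 'I_n}}) : {set {set 'I_n}} :=
  [set sigma' : {set 'I_n} | [exists sigma in X, sigma' \subset sigma]]%SET.

Definition cells (n k : nat) (Z : {set {set 'I_n}}) : {set {set 'I_n}} :=
  [set sigma in Z | #|sigma| == k.+1]%SET.

(* The complex Z_d(n, p) at the outcome w, chi n tau being the indicator of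
   the event that tau belongs to the hypergraph on [n]. Only the values
   chi n tau with tau eligible matter. *)
Definition upper_model (disp : measure_display) (T : measurableType disp)
    (R : realType) (P : probability T R)
    (chi : forall n : nat, {set 'I_n} -> {RV P >-> bool})
    (d n : nat) (w : T) : {set {set 'I_n}} :=
  upper_complex (hypergraph d (fun tau => chi n tau w)).

(* Independence is joint over all n and tau, not merely within each row. *)
Definition bernoulli_triangular_family (disp : measure_display)
    (T : measurableType disp) (R : realType) (P : probability T R)
    (d : nat) (p : nat -> nat -> R)
    (chi : forall n : nat, {set 'I_n} -> {RV P >-> bool}) : Prop :=
  mutually_independent (fun i : {n : nat & {set 'I_n}} => eligible d (tagged i))
    (fun i : {n : nat & {set 'I_n}} => chi (tag i) (tagged i)) /\
  (forall (n : nat) (tau : {set 'I_n}), eligible d tau ->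
     distribution P (chi n tau) =1 bernoulli_prob (p n #|tau|.-1)).

(* Main.v *)
Require Import Defs.
From HB Require Import structures.
From mathcomp Require Import all_boot all_order all_algebra.
From mathcomp Require Import all_classical all_reals all_analysis.
From mathcomp Require Import measurable_realfun ring lra.
Import Order.TTheory GRing.Theory Num.Theory.
Import numFieldNormedType.Exports.
Local Open Scope classical_set_scope.
Local Open Scope ring_scope.

(** Call a set [s] of [d] vertices missing when neither [s] nor any set of
    [d + 1] vertices around it belongs to the hypergraph; as [s] itself and its
    [n - d] cofaces are the only eligible sets containing [s], the
    [(d-1)]-cells of the complex are exactly the [d]-sets that are not missing.
    Let [M] be the number of missing [d]-sets, [N] the binomial coefficient
    [n] over [d], and [x] the probability [p_d(n)]. The claim is that [M / N]
    tends to 0 almost surely.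

    The mean of [M / N] is at most [(1 - x)^(n - d)], which tends to 0 because
    [n x] tends to infinity ([cvg_onemX0]). It need not be summable, so the
    fluctuation around the mean is treated apart, by a second moment.

    Being missing means avoiding a family of independent events. For two
    [d]-sets [s] and [t] with families [S] and [S'], the covariance of the
    indicators is the product over [S :|: S'] of the absence probabilities,
    times one minus the same product over [S :&: S']. For [s != t] the
    intersection contains at most a common coface, so the covariance is at
    most [(1 - x)^(n - d)] times the sum of [x] over the common cofaces. Summing
    over [t] counts each of the [n - d] cofaces of [s] at most [d + 1] times, and
    the total is at most [(d + 1) (n - d) x (1 - x)^(n - d)]. Keeping the last
    factor is what makes the case [d = 2] work: by the Bernoulli-type inequality
    [(1 - x)^k (1 + k x) <= 1] ([onemX_mulD1_le1]) this is bounded by [d + 1],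
    uniformly in [x] ([sum_cov_le]). Hence the variance of [M / N] is at most
    [(d + 2) / N], which is summable since [N] is at least of order [n^2].

    Finally, if the integrals of nonnegative functions are summable, then the
    functions have an almost everywhere finite sum, hence tend to 0 almost
    everywhere ([ae_cvg0_summable_integral]); applied to the squares of the
    centered ratios, this replaces Chebyshev and Borel-Cantelli. *)

Local Notation subsets_of_card n k := [set s : {set 'I_n} | #|s| == k]%SET.

(** * Second moments and almost everywhere convergence *)

Lemma Lfun1_indic {R : realType} {disp : measure_display}
    {T : measurableType disp} {P : probability T R} (A : set T) :
  measurable A -> (\1_A : T -> R) \in Lfun P 1.
Proof.
move=> mA; apply/Lfun1_integrable.
by apply: integrable_indic; rewrite ?(le_lt_trans (probability_le1 P mA)) ?ltry.
Qed.

Lemma covariance_indic {R : realType} {disp : measure_display}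
    {T : measurableType disp} {P : probability T R} (A B : set T) :
  measurable A -> measurable B ->
  (covariance P \1_A \1_B = P (A `&` B) - P A * P B)%E.
Proof.
move=> mA mB; have mAB : measurable (A `&` B) by exact: measurableI.
have AB1 : (\1_A * \1_B)%R = \1_(A `&` B) :> (T -> R) by rewrite indicI.
rewrite covarianceE ?AB1 ?Lfun1_indic//.
by rewrite !expectation_indic.
Qed.

Lemma integral_sqr_centered_sum {R : realType} {disp : measure_display}
    {T : measurableType disp} {P : probability T R} (I : finType)
    (D : {set I}) (A : I -> set T) (a : I -> R) :
  (forall i, measurable (A i)) -> (forall i, i \in D -> P (A i) = (a i)%:E) ->
  (\int[P]_w ((\sum_(i in D) (\1_(A i) w - a i)) ^+ 2)%:E =
   \sum_(i in D) \sum_(j in D) (P (A i `&` A j) - (a i * a j)%:E))%E.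
Proof.
move=> mA PA.
pose X (ij : I * I) (w : T) : \bar R :=
  ((\1_(A ij.1) w - a ij.1) * (\1_(A ij.2) w - a ij.2))%:E.
have bnd i w : `|\1_(A i) w - a i| <= 1 + `|a i|.
  apply: (le_trans (ler_normB _ _)); rewrite lerD2r indicE ger0_norm//.
  by case: (_ \in _) => //=.
have mX i : measurable_fun setT (fun w => \1_(A i) w - a i : R).
  by apply: measurable_funB => //; exact: measurable_indic.
have intX ij : P.-integrable setT (X ij).
  apply: measurable_bounded_integrable => //.
  - by rewrite (le_lt_trans (probability_le1 P _)) ?ltry.
  - exact: measurable_funM.
  - exists ((1 + `|a ij.1|) * (1 + `|a ij.2|)); split; first exact: num_real.
    move=> x xM w _ /=; apply/ltW/(le_lt_trans _ xM).
    by rewrite normrM ler_pM.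
transitivity (\int[P]_w (\sum_(ij | (ij.1 \in D) && (ij.2 \in D)) X ij w))%E.
  apply: eq_integral => w _.
  rewrite expr2 big_distrl/= -sumEFin.
  rewrite -(pair_big (mem D) (mem D) (fun i j => X (i, j) w))/=.
  apply: eq_bigr => i _.
  by rewrite big_distrr/= -sumEFin.
rewrite integral_sum//.
rewrite -(pair_big (mem D) (mem D) (fun i j => \int[P]_w X (i, j) w)%E)/=.
apply: eq_bigr => i iD.
apply: eq_bigr => j jD.
have := covariance_indic (P := P) (A i) (A j) (mA i) (mA j).
rewrite (PA i iD) (PA j jD) -EFinM => <-.
by rewrite unlock !expectation_indic// (PA i iD) (PA j jD) unlock.
Qed.

(** The sum of the series has a finite integral, so it is finite almost
    everywhere, and the terms of a convergent series tend to 0. *)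
Lemma ae_cvg0_summable_integral {R : realType} {disp : measure_display}
    {T : measurableType disp} {mu : {measure set T -> \bar R}}
    (f : nat -> T -> R) :
  (forall n, measurable_fun setT (f n)) -> (forall n w, 0 <= f n w) ->
  (\sum_(n <oo) \int[mu]_w (f n w)%:E < +oo)%E ->
  {ae mu, forall w, f n w @[n --> \oo] --> (0 : R)}.
Proof.
move=> mf f0 foo.
have mF n : measurable_fun setT (fun w => (f n w)%:E).
  exact/measurable_EFinP.
have F0 n w : setT w -> (0 <= (f n w)%:E)%E by rewrite lee_fin.
have intF : mu.-integrable setT (fun w => \sum_(n <oo) (f n w)%:E)%E.
  apply/integrableP; split.
    by apply: ge0_emeasurable_sum => // n w _ _; exact: F0.
  under eq_integral.
    move=> w _; rewrite gee0_abs; last first.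
      by apply: nneseries_ge0 => n _ _; exact: F0.
    over.
  by rewrite integral_nneseries.
apply: filterS (integrable_ae measurableT intF) => w /(_ I) fin.
have : cvgn (series (f ^~ w)).
  have /cvg_ex[l hl] : cvgn (fun n => \sum_(0 <= k < n) (f k w)%:E)%E.
    by apply: is_cvg_nneseries => n _ _; exact: F0.
  rewrite (cvg_lim (@ereal_hausdorff R) hl) in fin.
  rewrite -(fineK fin) in hl.
  apply/cvg_ex; exists (fine l).
  move/fine_cvgP: hl => [_]; apply: cvg_trans.
  apply: near_eq_cvg; near=> n.
  by rewrite /= sumEFin.
exact: (@cvg_series_cvg_0 R R^o).
Unshelve. all: by end_near. Qed.

(** The bound is the telescoping series of [c / (m + 1) - c / (m + 2)]. *)
Lemma nneseries_le_telescope_lty {R : realType} (c : R) (u : nat -> \bar R) :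
  0 <= c -> (forall m, (0 <= u m)%E) ->
  (forall m, (u m <= (c / (m.+1%:R * m.+2%:R))%:E)%E) ->
  (\sum_(m <oo) u m < +oo)%E.
Proof.
move=> c0 u0 uc; apply: (@le_lt_trans _ _ c%:E); last exact: ltry.
apply: lime_le; first by apply: is_cvg_nneseries => n _ _; exact: u0.
apply: nearW => k.
apply: (@le_trans _ _ (c * (1 - k.+1%:R^-1))%:E); last first.
  by rewrite lee_fin ler_piMr// gerBl invr_ge0.
elim: k => [|k IH].
  by rewrite big_geq// lee_fin invr1 subrr mulr0.
rewrite big_nat_recr//=; apply: (le_trans (leeD IH (uc k))).
rewrite -EFinD lee_fin -mulrDr ler_wpM2l//.
have k1 : k.+1%:R != 0 :> R by rewrite pnatr_eq0.
have k2 : k.+2%:R != 0 :> R by rewrite pnatr_eq0.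
rewrite le_eqVlt; apply/orP; left; apply/eqP.
have -> : k.+2%:R = k.+1%:R + 1 :> R by rewrite -natr1.
rewrite -natr1 in k2; field.
by rewrite nat1r k2 k1.
Qed.

(** * Elementary inequalities *)

(** Multiplying the bounds [(1 - x)^k] and [1 + k x <= (1 + x)^k] gives
    [(1 - x^2)^k <= 1]. This single estimate controls both the mean, as
    [(1 - x)^k <= 1 / (1 + k x)], and the covariances, as [k x (1 - x)^k <= 1]. *)
Lemma onemX_mulD1_le1 {R : realFieldType} (x : R) (k : nat) :
  0 <= x <= 1 -> (1 - x) ^+ k * (1 + k%:R * x) <= 1.
Proof.
move=> /andP[x0 x1]; elim: k => [|k IH].
  by rewrite expr0 mul0r addr0 mulr1.
apply: le_trans IH; rewrite exprSr -mulrA ler_wpM2l ?exprn_ge0 ?subr_ge0//.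
rewrite -natr1.
have : 0 <= k%:R :> R by [].
nra.
Qed.

Lemma cvg_onemX0 (R : realType) (d : nat) (x : nat -> R) :
  (forall n, (1 <= n)%N -> 0 <= x n <= 1) ->
  (fun n : nat => n%:R * x n) @ \oo --> +oo ->
  (1 - x n) ^+ (n - d) @[n --> \oo] --> (0 : R).
Proof.
move=> x01 /cvgryPge nx; apply/cvgr0Pnorm_le => e e0.
near=> n.
have n1 : (1 <= n)%N by near: n; exact: nbhs_infty_ge.
have /andP[x0 x1] := x01 n n1.
have nxe : d%:R + e^-1 <= n%:R * x n by near: n; exact: nx.
rewrite ger0_norm ?exprn_ge0 ?subr_ge0//.
have H := onemX_mulD1_le1 (x n) (n - d) (x01 n n1).
have dn : n%:R <= (n - d)%:R + d%:R :> R.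
  by rewrite -natrD ler_nat addnC -leq_subLR.
have B : e^-1 <= 1 + (n - d)%:R * x n.
  have : 0 <= d%:R :> R by [].
  nra.
rewrite -[leRHS]mul1r -ler_pdivrMr// (le_trans _ H)// ler_wpM2l//.
by rewrite exprn_ge0 ?subr_ge0.
Unshelve. all: by end_near. Qed.

(** The union bound for independent events of probabilities [x i]. *)
Lemma one_sub_prod_le_sum (R : realFieldType) (I : Type) (s : seq I)
    (Q : pred I) (x : I -> R) : (forall i, Q i -> 0 <= x i <= 1) ->
  1 - \prod_(i <- s | Q i) (1 - x i) <= \sum_(i <- s | Q i) x i.
Proof.
move=> x01; elim: s => [|i s IH]; first by rewrite !big_nil subrr.
rewrite !big_cons; case: ifPn => // Qi.
have /andP[xi0 xi1] := x01 i Qi.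
have : \prod_(j <- s | Q j) (1 - x j) <= 1.
  by apply: prodr_ile1 => j /x01 /andP[? ?]; rewrite subr_ge0 gerBl; apply/andP.
have : 0 <= \prod_(j <- s | Q j) (1 - x j).
  by apply: prodr_ge0 => j /x01 /andP[? ?]; rewrite subr_ge0.
nra.
Qed.

Lemma prod_setUI (R : comRingType) (I : finType) (A B : {set I}) (F : I -> R) :
  (\prod_(i in A :|: B) F i) * (\prod_(i in A :&: B) F i) =
  (\prod_(i in A) F i) * (\prod_(i in B) F i).
Proof.
rewrite (big_setID A)/= [X in _ = _ * X](big_setID A)/= finset.setUK.
rewrite finset.setDUl finset.setDv finset.set0U (finset.setIC B A).
by rewrite -!mulrA; congr (_ * _); rewrite mulrC.
Qed.

Lemma ler_prod_subset (R : realFieldType) (I : finType) (A B : {set I})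
    (F : I -> R) : A \subset B -> (forall i, i \in B -> 0 <= F i <= 1) ->
  \prod_(i in B) F i <= \prod_(i in A) F i.
Proof.
move=> AB F01; rewrite (big_setID A)/= (finset.setIidPr AB) ler_piMr//.
  apply: prodr_ge0 => i iA.
  by have /andP[] := F01 i (fintype.subsetP AB i iA).
by apply: prodr_ile1 => i; rewrite inE => /andP[_ /F01].
Qed.

(** By symmetry the binomial coefficient counts [m]-subsets, and there are more
    of them in a set of [m + d] elements than in one of [m + 2]. *)
Lemma bin_ge_bin2 (m d : nat) :
  (2 <= d)%N -> (m.+1 * m.+2 <= 2 * 'C(m + d, d))%N.
Proof.
move=> d2; have -> : (m.+1 * m.+2 = 2 * 'C(m.+2, m))%N.
  have := @bin_sub m.+2 2 isT; rewrite subn2 /= => ->.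
  by rewrite mulnC (mulnC 2%N) (bin_ffact m.+2 2) !ffactnS/= muln1.
rewrite leq_mul2l/= -{1}(bin_sub (leq_addl m d)) addnK.
by rewrite leq_bin2l// -addn2 leq_add2l.
Qed.

(** * Covariances of missing cells *)

(** A [d]-set [s] is missing exactly when none of these sets belongs to the
    hypergraph. *)
Definition supcells {n : nat} (d : nat) (s : {set 'I_n}) :
    {set {set 'I_n}} :=
  [set t | eligible d t & s \subset t]%SET.

Definition cofaces {n : nat} (s : {set 'I_n}) : {set {set 'I_n}} :=
  [set t : {set 'I_n} | s \subset t & #|t| == #|s|.+1]%SET.

(** Cofaces of [s] arise by adding one vertex outside [s]. *)
Lemma card_cofaces (n : nat) (s : {set 'I_n}) : #|cofaces s| = (n - #|s|)%N.
Proof.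
have -> : cofaces s = [set x |: s | x in ~: s]%SET.
  apply/finset.setP => t; rewrite inE; apply/andP/imsetP => [[st /eqP ct]|[x]].
    have /eqP/cards1P[x xE] : #|t :\: s|%SET = 1%N.
      by rewrite cardsD (finset.setIidPr st) ct subSnn.
    have xts : x \in (t :\: s)%SET by rewrite xE inE.
    exists x; first by move: xts; rewrite !inE => /andP[].
    by rewrite -xE -{2}(finset.setIidPr st) finset.setUC finset.setID.
  by rewrite inE => xs ->; rewrite finset.subsetUr cardsU1 xs.
rewrite card_in_imset; first by rewrite cardsCs finset.setCK card_ord.
move=> x y; rewrite !inE => xs ys /finset.setP /(_ x).
by rewrite !inE eqxx (negbTE xs) !orbF => /esym/eqP.
Qed.

Section row.
Context {R : realFieldType} {d n : nat} (p : nat -> R).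
Hypothesis d2 : (2 <= d)%N.
Hypothesis p01 : forall j, (1 <= j <= d)%N -> 0 <= p j <= 1.

Definition absence_prob (t : {set 'I_n}) : R := 1 - p #|t|.-1.

Lemma absence_prob01 t : eligible d t -> 0 <= absence_prob t <= 1.
Proof.
by move=> /p01 /andP[? ?]; rewrite /absence_prob subr_ge0 gerBl; apply/andP.
Qed.

Lemma cofaces_supcells (s : {set 'I_n}) : #|s| = d ->
  cofaces s \subset supcells d s.
Proof.
move=> sd; apply/fintype.subsetP => t; rewrite !inE => /andP[-> /eqP ct].
by rewrite /eligible ct sd /= leqnn (leq_trans _ d2).
Qed.

Lemma prod_cofaces (s : {set 'I_n}) : #|s| = d ->
  \prod_(t in cofaces s) absence_prob t = (1 - p d) ^+ (n - d).
Proof.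
move=> sd; rewrite -sd -card_cofaces -prodr_const; apply: eq_bigr => t.
by rewrite inE /absence_prob => /andP[_ /eqP ->].
Qed.

(** This bounds the probability that [s] is missing; only the cofaces of [s] are
    kept among the factors. *)
Lemma prod_supcells_le (s : {set 'I_n}) : #|s| = d ->
  \prod_(t in supcells d s) absence_prob t <= (1 - p d) ^+ (n - d).
Proof.
move=> sd; rewrite -(prod_cofaces s)//.
apply: ler_prod_subset (cofaces_supcells s sd) _.
by move=> t; rewrite inE => /andP[/absence_prob01].
Qed.

(** The sum of the covariances of the missing indicator of [s] with those of all
    [d]-sets is bounded independently of [n] and of the probabilities: the
    diagonal term contributes at most 1, and the others at most [d + 1]. *)
Lemma sum_cov_le (s : {set 'I_n}) : #|s| = d ->
  \sum_(t in subsets_of_card n d)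
    (\prod_(u in (supcells d s :|: supcells d t)%SET) absence_prob u -
     \prod_(u in supcells d s) absence_prob u *
     \prod_(u in supcells d t) absence_prob u)
  <= d.+2%:R.
Proof.
move=> sd.
have up01 t u : u \in supcells d t -> 0 <= absence_prob u <= 1.
  by rewrite inE => /andP[/absence_prob01].
have upU01 t u : u \in (supcells d s :|: supcells d t)%SET ->
    0 <= absence_prob u <= 1.
  by rewrite inE => /orP[] /up01.
have dd : (1 <= d <= d)%N by rewrite leqnn (leq_trans _ d2).
have /andP[pd0 pd1] := p01 d dd.
rewrite (bigD1 s)/=; last by rewrite inE sd.
rewrite -nat1r lerD//.
  (* an indicator of mean [a] has variance [a - a^2] *)
  rewrite finset.setUid.
  have a0 : 0 <= \prod_(u in supcells d s) absence_prob u.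
    by apply: prodr_ge0 => u /up01 /andP[].
  have a1 : \prod_(u in supcells d s) absence_prob u <= 1.
    by apply: prodr_ile1 => u /up01.
  nra.
set k := (n - d)%N; set x := p d.
apply: (@le_trans _ _ (\sum_(t in subsets_of_card n d | t != s)
    ((1 - x) ^+ k * \sum_(u in cofaces s | t \subset u) x))).
  apply: ler_sum => t /andP[]; rewrite inE => /eqP td ts.
  rewrite -prod_setUI -{1}[X in X - _]mulr1 -mulrBr.
  apply: ler_pM.
  - by apply: prodr_ge0 => u /upU01 /andP[].
  - rewrite subr_ge0; apply: prodr_ile1 => u; rewrite inE => /andP[/up01//].
  - rewrite -(prod_cofaces s)//; apply: ler_prod_subset (upU01 t).
    by rewrite (fintype.subset_trans (cofaces_supcells s sd))// finset.subsetUl.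
  (* distinct [d]-sets have no eligible common superset but common cofaces *)
  - have -> : \sum_(u in cofaces s | t \subset u) x =
              \sum_(u in (supcells d s :&: supcells d t)%SET) p #|u|.-1.
      apply: eq_big => u; last first.
        by move=> /andP[]; rewrite inE sd => /andP[_ /eqP ->].
      rewrite !inE; apply/andP/idP => [[/andP[su /eqP cu] tu]|].
        by rewrite su tu /eligible cu sd /= dd.
      move=> /andP[/andP[/andP[_ eu] su] /andP[_ tu]]; split => //.
      rewrite su eqn_leq sd /=; apply/andP; split.
        by move: eu; case: #|u|.
      rewrite ltnNge; apply/negP => ud; case/eqP: ts.
      have /eqP -> : t == u by rewrite eqEcard tu td.
      by apply/esym/eqP; rewrite eqEcard su sd.
    apply: one_sub_prod_le_sum => u.
    by rewrite !inE => /andP[/andP[/p01]].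
rewrite -mulr_sumr.
(* a coface has [d + 1] subsets of cardinality [d], hence double counting *)
have -> : \sum_(t in subsets_of_card n d | t != s)
    \sum_(u in cofaces s | t \subset u) x =
  \sum_(u in cofaces s)
    \sum_(t in subsets_of_card n d | (t != s) && (t \subset u)) x.
  rewrite (exchange_big_dep (mem (cofaces s)))/=; last by move=> ? ? _ /andP[].
  by apply: eq_bigr => u uc; apply: eq_bigl => t; rewrite uc -andbA.
apply: (@le_trans _ _ ((1 - x) ^+ k * (k%:R * x) * d.+1%:R)); last first.
  rewrite ler_piMl//; apply: le_trans (onemX_mulD1_le1 x k _); last exact/andP.
  by rewrite ler_wpM2l ?exprn_ge0 ?subr_ge0// lerDr.
rewrite -mulrA ler_wpM2l ?exprn_ge0 ?subr_ge0//.
have <- : \sum_(u in cofaces s) x * d.+1%:R = k%:R * x * d.+1%:R.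
  by rewrite sumr_const card_cofaces sd -mulrA mulr_natl.
apply: ler_sum => u; rewrite inE sd => /andP[_ /eqP cu].
rewrite sumr_const -[X in X <= _]mulr_natr ler_wpM2l// ler_nat.
rewrite -(binSn d) -cu -cards_draws; apply: subset_leq_card.
apply/fintype.subsetP => t /andP[]; rewrite !inE => td /andP[_ tu].
by rewrite tu td.
Qed.

End row.

(** * The random complex *)

Definition none_present {R : realType} {disp : measure_display}
    {T : measurableType disp} {P : probability T R} {n : nat}
    (x : {set 'I_n} -> {RV P >-> bool}) (S : {set {set 'I_n}}) : set T :=
  \bigcap_(t in [set` S]) (x t @^-1` [set false]).

Lemma measurable_none_present {R : realType} {disp : measure_display}
    {T : measurableType disp} {P : probability T R} (n : nat)
    (x : {set 'I_n} -> {RV P >-> bool}) (S : {set {set 'I_n}}) :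
  measurable (none_present x S).
Proof. by apply: fin_bigcap_measurable => // t _; exact: measurable_funPTI. Qed.

Lemma none_presentU {R : realType} {disp : measure_display}
    {T : measurableType disp} {P : probability T R} (n : nat)
    (x : {set 'I_n} -> {RV P >-> bool}) (S S' : {set {set 'I_n}}) :
  none_present x S `&` none_present x S' = none_present x (S :|: S')%SET.
Proof.
rewrite /none_present -bigcap_setU; congr (\bigcap_(t in _) _).
by apply/seteqP; split => t /=; rewrite finset.in_setU => /orP.
Qed.

Lemma probability_none_present {R : realType} {disp : measure_display}
    {T : measurableType disp} {P : probability T R} {d n : nat}
    {p : nat -> nat -> R} {chi : forall n : nat, {set 'I_n} -> {RV P >-> bool}}
    (hp : forall j, (1 <= j <= d)%N -> 0 <= p n j <= 1)
    (hchi : bernoulli_triangular_family d p chi)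
    (S : {set {set 'I_n}}) :
  (forall t, t \in S -> eligible d t) ->
  P (none_present (chi n) S) = (\prod_(t in S) absence_prob (p n) t)%:E.
Proof.
move=> elS; have [indep ber] := hchi.
pose tag_n (t : {set 'I_n}) : {n : nat & {set 'I_n}} :=
  Tagged (fun n => {set 'I_n}) t.
have tag_inj : injective tag_n by move=> t u /eqP; rewrite eq_Tagged => /eqP.
have := indep (map tag_n (enum S)) (fun _ => [set false]).
rewrite map_inj_uniq ?enum_uniq// all_map => /(_ isT).
have -> : all (preim tag_n (fun i => eligible d (tagged i))) (enum S).
  by apply/allP => t; rewrite mem_enum => /elS.
move=> /(_ isT (fun _ => I)); rewrite !big_map/=.
rewrite -bigcap_seq.
have -> : [set` enum S] = [set` S].
  by apply/seteqP; split => t /=; rewrite mem_enum.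
move=> ->; rewrite big_enum -prodEFin; apply: eq_bigr => t tS.
have := ber n t (elS t tS) [set false].
rewrite /distribution /pushforward => ->.
by rewrite /bernoulli_prob hp ?fsbig_set1//; exact: elS.
Qed.

Lemma card_cells_upper_model {R : realType} {disp : measure_display}
    {T : measurableType disp} {P : probability T R} (d n : nat)
    (chi : forall n : nat, {set 'I_n} -> {RV P >-> bool}) (w : T) :
  (0 < d)%N ->
  #|cells d.-1 (upper_model chi d n w)|%:R = 'C(n, d)%:R -
  \sum_(s in subsets_of_card n d)
    \1_(none_present (chi n) (supcells d s)) w :> R.
Proof.
move=> d0.
have -> : 'C(n, d)%:R =
    \sum_(s in subsets_of_card n d) (1 : R).
  by rewrite sumr_const card_draws card_ord.
rewrite -sum1_card natr_sum -sumrB.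
rewrite (eq_bigl (fun s => (s \in subsets_of_card n d)
  && (s \in upper_model chi d n w))); last first.
  by move=> s; rewrite !inE prednK// andbC.
rewrite big_mkcondr/=; apply: eq_bigr => s _.
rewrite indicE; case: ifPn => sZ.
  rewrite memNset ?subr0// => none.
  move: sZ; rewrite inE => /existsP[t /andP[]]; rewrite inE => /andP[et xt] st.
  have := none t; rewrite /= inE et st => /(_ isT).
  by rewrite xt.
rewrite mem_set ?subrr// => t /=; rewrite inE => /andP[et st].
apply: contraNF sZ => xt; rewrite inE; apply/existsP; exists t.
by rewrite inE et xt st.
Qed.

(** This is [sum_cov_le] summed over [s]: the variance of the number of missing
    [d]-sets is of the order of their total number. *)
Lemma integral_sqr_missing_le {R : realType} {disp : measure_display}
    {T : measurableType disp} {P : probability T R} {d n : nat}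
    {p : nat -> nat -> R} {chi : forall n : nat, {set 'I_n} -> {RV P >-> bool}}
    (hd : (2 <= d)%N)
    (hp : forall j, (1 <= j <= d)%N -> 0 <= p n j <= 1)
    (hchi : bernoulli_triangular_family d p chi) :
  (\int[P]_w ((\sum_(s in subsets_of_card n d)
     (\1_(none_present (chi n) (supcells d s)) w -
      \prod_(t in supcells d s) absence_prob (p n) t)) ^+ 2)%:E <=
   ('C(n, d)%:R * d.+2%:R)%:E)%E.
Proof.
have elup s t : t \in supcells d s -> eligible d t.
  by rewrite inE => /andP[].
have cov s t : (P (none_present (chi n) (supcells d s) `&`
                  none_present (chi n) (supcells d t)) -
    (\prod_(u in supcells d s) absence_prob (p n) u *
     \prod_(u in supcells d t) absence_prob (p n) u)%:E =
    (\prod_(u in (supcells d s :|: supcells d t)%SET)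
        absence_prob (p n) u -
     \prod_(u in supcells d s) absence_prob (p n) u *
     \prod_(u in supcells d t) absence_prob (p n) u)%:E)%E.
  rewrite none_presentU (probability_none_present hp hchi)//.
  by move=> u; rewrite finset.in_setU => /orP[] /elup.
rewrite integral_sqr_centered_sum; first last.
- move=> s _; apply: (probability_none_present hp hchi) => t.
  exact: elup.
- by move=> s; exact: measurable_none_present.
rewrite (eq_bigr (fun s : {set 'I_n} =>
  (\sum_(t in subsets_of_card n d)
    (\prod_(u in (supcells d s :|: supcells d t)%SET)
        absence_prob (p n) u -
     \prod_(u in supcells d s) absence_prob (p n) u *
     \prod_(u in supcells d t) absence_prob (p n) u))%:E)); last first.
  by move=> s _; rewrite -sumEFin; apply: eq_bigr => t _; exact: cov.
rewrite sumEFin lee_fin.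
have <- : \sum_(s in subsets_of_card n d) (d.+2%:R : R) =
    'C(n, d)%:R * d.+2%:R.
  by rewrite sumr_const mulr_natl card_draws card_ord.
apply: ler_sum => s; rewrite inE => /eqP sd.
exact: sum_cov_le.
Qed.

Theorem lemma23 (R : realType) (disp : measure_display)
    (T : measurableType disp) (P : probability T R) (d : nat)
    (hd : (2 <= d)%N) (p : nat -> nat -> R)
    (hp : forall n j : nat, (1 <= n)%N -> (1 <= j <= d)%N -> 0 < p n j <= 1)
    (hnp : (fun n : nat => n%:R * p n d) @ \oo --> +oo)
    (chi : forall n : nat, {set 'I_n} -> {RV P >-> bool})
    (hchi : bernoulli_triangular_family d p chi) :
  {ae P, forall w : T,
    (fun n : nat => #|cells d.-1 (upper_model chi d n w)|%:R / 'C(n, d)%:R : R)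
      @ \oo --> (1 : R)}.
Proof.
have p01 n : (1 <= n)%N -> forall j, (1 <= j <= d)%N -> 0 <= p n j <= 1.
  by move=> n1 j jd; have /andP[/ltW -> ->] := hp n j n1 jd.
have d0 : (0 < d)%N by exact: leq_trans hd.
have md m : (1 <= m + d)%N by rewrite addn_gt0 d0 orbT.
pose D n := subsets_of_card n d.
pose a n (s : {set 'I_n}) : R :=
  \prod_(t in supcells d s) absence_prob (p n) t.
pose A n (s : {set 'I_n}) := none_present (chi n) (supcells d s).
pose N n : R := 'C(n, d)%:R.
pose Y n (w : T) : R := \sum_(s in D n) (\1_(A n s) w - a n s).
have Ngt0 m : 0 < N (m + d)%N by rewrite ltr0n bin_gt0 leq_addl.
have mY n : measurable_fun setT (Y n).
  rewrite /Y; under eq_fun do rewrite -big_enum.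
  apply: measurable_sum => s; apply: measurable_funB => //.
  by apply: measurable_indic; exact: measurable_none_present.
(* the rows are shifted by [d] so that [N] is positive *)
pose f m (w : T) : R := (N (m + d)%N ^- 2) * Y (m + d)%N w ^+ 2.
have f_ge0 m w : 0 <= f m w by rewrite mulr_ge0 ?invr_ge0 ?sqr_ge0.
have mf m : measurable_fun setT (f m).
  by apply: measurable_funM => //; exact: measurable_funX.
have sumf : (\sum_(m <oo) \int[P]_w (f m w)%:E < +oo)%E.
  apply: (nneseries_le_telescope_lty (2 * d.+2%:R)) => // [m|m].
    by apply: integral_ge0 => w _; rewrite lee_fin.
  under eq_integral do rewrite /f EFinM.
  rewrite ge0_integralZl_EFin//; first last.
  - by rewrite invr_ge0 sqr_ge0.
  - exact/measurable_EFinP/measurable_funX.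
  - by move=> w _; rewrite lee_fin sqr_ge0.
  apply: (le_trans (lee_wpmul2l _ (integral_sqr_missing_le hd
    (p01 _ (md m)) hchi))).
    by rewrite lee_fin invr_ge0 sqr_ge0.
  rewrite -EFinM lee_fin.
  have -> : N (m + d)%N ^- 2 * ('C(m + d, d)%:R * d.+2%:R) =
      d.+2%:R / N (m + d)%N.
    by rewrite /N; field; rewrite lt0r_neq0// Ngt0.
  rewrite ler_pdivrMr// mulrAC ler_pdivlMr// ?mulr_gt0//.
  rewrite -[2 * _ * _]mulrAC [leRHS]mulrC ler_wpM2l// /N -!natrM ler_nat.
  exact: bin_ge_bin2.
have mean0 : (\sum_(s in D n) a n s) / N n @[n --> \oo] --> (0 : R).
  have dd : (1 <= d <= d)%N by rewrite d0 leqnn.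
  apply: (@squeeze_cvgr _ _ _ _ (cst 0) (fun n => (1 - p n d) ^+ (n - d))).
  - near=> n.
    have n1 : (1 <= n)%N by near: n; exact: nbhs_infty_ge.
    have nd : (d <= n)%N by near: n; exact: nbhs_infty_ge.
    have N0 : 0 < N n by rewrite ltr0n bin_gt0.
    apply/andP; split.
      apply: divr_ge0; last exact: ltW.
      apply: sumr_ge0 => s _; apply: prodr_ge0 => t; rewrite inE => /andP[et _].
      by have /andP[] := absence_prob01 _ (p01 n n1) t et.
    rewrite ler_pdivrMr// mulr_natr.
    have <- : \sum_(s in D n) (1 - p n d) ^+ (n - d) =
        (1 - p n d) ^+ (n - d) *+ 'C(n, d).
      by rewrite sumr_const card_draws card_ord.
    apply: ler_sum => s; rewrite inE => /eqP sd.
    by apply: prod_supcells_le => //; exact: p01.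
  - exact: cvg_cst.
  - by apply: cvg_onemX0 => // n n1; exact: p01.
apply: filterS (ae_cvg0_summable_integral f mf f_ge0 sumf) => w fw.
have Y0 : Y n w / N n @[n --> \oo] --> (0 : R).
  rewrite -(cvg_shiftn d); apply/cvgr0Pnorm_lt => e e0.
  have e2 : 0 < e ^+ 2 by rewrite exprn_gt0.
  move/cvgr0Pnorm_lt : fw => /(_ _ e2); apply: filterS => m /=.
  rewrite ger0_norm// /f => fe.
  rewrite -(@ltr_pXn2r _ 2)// ?nnegrE//; last exact: ltW.
  by rewrite real_normK ?num_real// expr_div_n mulrC.
(* the missing fraction is its fluctuation plus its mean *)
have : 1 - (Y n w / N n + (\sum_(s in D n) a n s) / N n)
    @[n --> \oo] --> (1 : R).
  rewrite -[X in _ --> X]subr0 -[X in _ --> _ - X]addr0.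
  by apply: cvgB; [exact: cvg_cst|exact: cvgD].
apply: cvg_trans; apply: near_eq_cvg; near=> n.
have nd : (d <= n)%N by near: n; exact: nbhs_infty_ge.
have N0 : N n != 0 by rewrite pnatr_eq0 -lt0n bin_gt0.
rewrite /= card_cells_upper_model// -mulrDl /Y sumrB subrK.
by rewrite mulrBl divff.
Unshelve. all: by end_near. Qed.
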